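(* Let $m$ be a positive integer, suppose that the index set $T$ is a bounded subset of $\mathbb{R}^m$, and let $\|\cdot\|$ be any norm on $\mathbb{R}^m$. Let $T_c\subseteq\mathbb{R}^m$ be an open set that includes the convex hull of $T$ and let $p_{T_c}\colon\mathbb{R}\times T_c\to\mathbb{R}$ be a Borel measurable map such that $p_t=p_{T_c}(\cdot,t)$ for every $t\in T$. Assume that $p_{T_c}$ is differentiable with respect to its second argument $t$ (on all of $T_c$). If there is some Borel measurable map $F\colon\mathbb{R}\to\mathbb{R}$ such that $\int_{\mathbb{R}}|f(x)|F(x)\,\mathrm{d}x<+\infty$ and $$\|\nabla_t p_{T_c}(x,t)\|\leqslant F(x)\quad\text{for all }x\in\mathbb{R}\text{ and }t\in T_c,$$ then the importance sampling estimator $\hat{\underline{\mathrm{E}}}_n^{\mathscr{P}/P}(f)$ is a strongly consistent estimator of $\underline{\mathrm{E}}^{\mathscr{P}}(f)$.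
   Context: Setting. $\mathscr{B}$ is the Borel $\sigma$-field on $\mathbb{R}$. $T$ is a non-empty index set and $\mathscr{P}=\{P_t : t\in T\}$ is a set of probability measures on $(\mathbb{R},\mathscr{B})$, each absolutely continuous with respect to Lebesgue measure, with density $p_t$. $P$ is a (central) probability measure on $(\mathbb{R},\mathscr{B})$, not necessarily in $\mathscr{P}$, that is also absolutely continuous, with density $p$. With $\operatorname{supp}q:=\{x\in\mathbb{R}: q(x)>0\}$ for a density $q$, it is assumed that $\operatorname{supp}p\supseteq\operatorname{supp}p_t$ for all $t\in T$. For a probability measure $Q$, $\mathrm{E}^Q(h)=\int h\,\mathrm{d}Q$. The map $f\colon\mathbb{R}\to\mathbb{R}$ is Borel measurable with $\sup_{t\in T}\mathrm{E}^{P_t}(|f|)<+\infty$, and $\underline{\mathrm{E}}^{\mathscr{P}}(f):=\inf_{t\in T}\mathrm{E}^{P_t}(f)$. For each $t\in T$, $f_t\colon\mathbb{R}\to\mathbb{R}$ is a Borel measurable map that satisfies $f_t(x)=f(x)\,p_t(x)/p(x)$ for all $x\in\operatorname{supp}p$ (values outside $\operatorname{supp}p$, a $P$-null set, are irrelevant). The symbol $\nabla_t$ denotes the gradient $\big(\frac{\partial}{\partial t_1},\dots,\frac{\partial}{\partial t_m}\big)$ with respect to $t=(t_1,\dots,t_m)\in\mathbb{R}^m$. Sampling. $(\mathbb{R}^\infty,\mathscr{B}^\infty,P^\infty)$ is the countably infinite product of copies of $(\mathbb{R},\mathscr{B},P)$ and $X_k\colon\mathbb{R}^\infty\to\mathbb{R}$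 is the $k$-th coordinate projection. The importance sampling estimator is the (not necessarily measurable) extended real-valued map $$\hat{\underline{\mathrm{E}}}_n^{\mathscr{P}/P}(f):=\inf_{t\in T}\frac1n\sum_{k=1}^n f_t(X_k)\quad\Big(=\inf_{t\in T}\frac1n\sum_{k=1}^n f(X_k)\frac{p_t(X_k)}{p(X_k)}\ \text{ when all } X_k\in\operatorname{supp}p\Big).$$ Strong consistency. For any map $h\colon\mathbb{R}^\infty\to\overline{\mathbb{R}}:=\mathbb{R}\cup\{-\infty,+\infty\}$, $h^*$ denotes a minimal measurable cover: a measurable map $h^*\colon\mathbb{R}^\infty\to\overline{\mathbb{R}}$ with $h^*\geqslant h$ and such that every measurable $g\colon\mathbb{R}^\infty\to\overline{\mathbb{R}}$ with $g\geqslant h$ satisfies $g\geqslant h^*$ $P^\infty$-almost surely; it always exists and is unique up to $P^\infty$-null sets. The estimator is strongly consistent if $\big|\hat{\underline{\mathrm{E}}}_n^{\mathscr{P}/P}(f)-\underline{\mathrm{E}}^{\mathscr{P}}(f)\big|^*\to0$ $P^\infty$-almost surely as $n\to+\infty$, where $|h|^*$ is the minimal measurable cover of $|h|$. *)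

(* Defs.v *)
From HB Require Import structures.
From mathcomp Require Import all_boot all_order all_algebra.
From mathcomp Require Import all_classical all_reals all_analysis measurable_realfun.

Set Implicit Arguments.
Unset Strict Implicit.
Unset Printing Implicit Defensive.
Import Order.TTheory GRing.Theory Num.Theory.
Import numFieldNormedType.Exports.
Local Open Scope classical_set_scope.
Local Open Scope ring_scope.

Definition is_norm (R : realType) (m : nat) (N : 'rV[R]_m -> R) : Prop :=
  [/\ forall x y, N (x + y) <= N x + N y,
      forall a x, N (a *: x) = `|a| * N x
    & forall x, N x = 0 -> x = 0].

Definition gradient (R : realType) (m : nat) (g : 'rV[R]_m -> R)
    (t : 'rV[R]_m) : 'rV[R]_m :=
  \row_(i < m) 'D_(delta_mx ord0 i) g t.

Definition convex_hull (R : realType) (m : nat) (A : set 'rV[R]_m) :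
    set 'rV[R]_m :=
  smallest (@convex_set R 'rV[R]_m) A.

(* The domain carries the Borel sigma-algebra of the product topology; on the
   open set [D] its trace is the Borel sigma-algebra of the subspace. *)
Definition borel_measurable_on (R : realType) (m : nat)
    (D : set (R * 'rV[R]_m)) (g : R * 'rV[R]_m -> R) : Prop :=
  measurable_fun
    (D : set (g_sigma_algebraType (@open (R * 'rV[R]_m)%type)))
    (g : g_sigma_algebraType (@open (R * 'rV[R]_m)%type) -> R).

Definition supp (R : realType) (q : R -> R) : set R := [set x | 0 < q x].

Definition is_density (R : realType) (P : probability R R)
    (q : R -> R) : Prop :=
  [/\ measurable_fun [set: R] q,
      forall x, 0 <= q x
    & forall A : set R, measurable A ->
        P A = (\int[lebesgue_measure]_(x in A) (q x)%:E)%E].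

Definition cylinder_sets (R : realType) : set_system (nat -> R) :=
  [set A | exists k (B : set R),
             measurable B /\ A = [set w : nat -> R | B (w k)]].

Notation sample_space R := (g_sigma_algebraType (@cylinder_sets R)).

(* The values on finite-dimensional measurable rectangles determine the
   infinite product measure uniquely. *)
Definition is_product_measure (R : realType)
    (P : probability R R)
    (Q : probability (sample_space R) R) : Prop :=
  forall (n : nat) (A : nat -> set R),
    (forall k, measurable (A k)) ->
    Q [set w : nat -> R | forall k, (k < n)%N -> A k (w k)] =
      (\prod_(k < n) P (A k))%E.

Definition minimal_measurable_cover (d : measure_display)
    (Om : measurableType d) (R : realType) (Q : probability Om R)
    (h hs : Om -> \bar R) : Prop :=
  [/\ measurable_fun [set: Om] hs,
      forall w, (h w <= hs w)%E
    & forall g : Om -> \bar R, measurable_fun [set: Om] g ->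
        (forall w, (h w <= g w)%E) -> {ae Q, forall w, (hs w <= g w)%E}].

(* Minimal covers exist and are unique up to null sets, so asking for one
   choice of covers is the same as asking for all. *)
Definition strongly_consistent (d : measure_display)
    (Om : measurableType d) (R : realType) (Q : probability Om R)
    (est : nat -> Om -> \bar R) (theta : \bar R) : Prop :=
  exists hs : nat -> Om -> \bar R,
    (forall n, (0 < n)%N ->
       minimal_measurable_cover Q (fun w => `|est n w - theta|%E) (hs n)) /\
    {ae Q, forall w, hs n w @[n --> \oo] --> 0%E}.

Definition lower_expectation (R : realType) (I : Type) (T : set I)
    (Pt : I -> probability R R)
    (f : R -> R) : \bar R :=
  ereal_inf [set 'E_(Pt t)[f]%E | t in T].

Definition importance_sampling_estimator (R : realType) (I : Type) (T : set I)
    (ft : I -> R -> R) (n : nat) (w : nat -> R) : \bar R :=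
  ereal_inf [set (n%:R^-1 * \sum_(k < n) ft t (w k))%:E | t in T].

(* Main.v *)
(* By the mean value theorem along segments of the convex hull and the
   equivalence of norms, |p_s(x) - p_t(x)| <= L F(x) |s - t| for s, t in T, so on
   supp p the weights t |-> f_t(x) are Lipschitz with constant
   G(x) = L |f(x)| F(x) / p(x), and G is P-integrable. Finite nets of the bounded
   set T and the strong law for G and for countably many f_t then give a uniform
   strong law over T, and the infima converge. Almost surely the infimum over T is
   an infimum over a countable dense subset; this yields an explicit minimal
   measurable cover.

   The strong law for integrable functions comes from the bounded case (second
   moments along squares) by L1-approximation: Garsia's maximal ergodic
   inequality for the shift controls all the averages of the error at once. *)

Require Import Defs.
From HB Require Import structures.
From mathcomp Require Import all_boot all_order all_algebra.
From mathcomp Require Import all_classical all_reals all_analysis measurable_realfun.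
From mathcomp Require Import zify ring lra.

Set Implicit Arguments.
Unset Strict Implicit.
Unset Printing Implicit Defensive.
Import Order.TTheory GRing.Theory Num.Theory.
Import numFieldNormedType.Exports.
Local Open Scope classical_set_scope.
Local Open Scope ring_scope.

(** * Change of density *)

(** Absolute continuity yields a Radon-Nikodym derivative of [P]. It agrees [mu]-almost everywhere
    with [q], since both have the same integral over every measurable set, and its change of
    variables formula transfers to [q]. *)
Lemma ge0_integral_abs_continuous d (T : measurableType d) (R : realType)
    (mu : {sigma_finite_measure set T -> \bar R}) (P : probability T R)
    (q : T -> R) (h : T -> \bar R) :
  measurable_fun setT q ->
  (forall A, measurable A -> P A = (\int[mu]_(x in A) (q x)%:E)%E) ->
  measurable_fun setT h -> (forall x, (0 <= h x)%E) ->
  (\int[P]_x h x = \int[mu]_x (h x * (q x)%:E))%E.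
Proof.
move=> mq Pq mh h0.
have Pmu : P `<< mu.
  apply/null_content_dominatesP => A mA muA0.
  rewrite Pq//; apply: null_set_integral => //.
  exact/measurable_funTS/measurable_EFinP.
rewrite -(Radon_Nikodym_SigmaFinite.change_of_variables Pmu)//.
have mRN : measurable_fun setT (Radon_Nikodym_SigmaFinite.f P mu).
  exact: measurable_int (Radon_Nikodym_SigmaFinite.f_integrable Pmu).
apply: ae_eq_integral => //.
- exact: emeasurable_funM.
- by apply: emeasurable_funM => //; exact/measurable_EFinP.
- apply: ae_eqe_mul2l; apply: integral_ae_eq => //.
  + exact: Radon_Nikodym_SigmaFinite.f_integrable.
  + exact/measurable_EFinP.
  + move=> E _ mE; rewrite -(Pq _ mE).
    exact/esym/(Radon_Nikodym_SigmaFinite.f_integral Pmu).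
Qed.

(* The Lebesgue measure lives on [measurableTypeR R], which has the same sets as
   the canonical measurable structure of [R] but another display; the
   pushforward along the identity transports [P] there. *)
Lemma ge0_integral_density (R : realType) (P : probability R R) (q : R -> R)
    (h : R -> \bar R) :
  is_density P q -> measurable_fun setT h -> (forall x, (0 <= h x)%E) ->
  (\int[P]_x h x = \int[lebesgue_measure]_x (h x * (q x)%:E))%E.
Proof.
move=> [mq q0 Pq] mh h0.
have mid : measurable_fun [set: R] (id : R -> measurableTypeR R).
  by move=> _ A mA; rewrite setTI.
pose idm := HB.pack_for {mfun R >-> measurableTypeR R}
  (id : R -> measurableTypeR R) (isMeasurableFun.Build _ _ _ _ _ mid).
have := @ge0_integral_abs_continuous _ (measurableTypeR R) R lebesgue_measure
  (distribution P idm) q h mq Pq mh h0.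
move=> <-; have := ge0_integral_pushforward mid P measurableT mh (fun y _ => h0 y).
by rewrite preimage_setT => ->.
Qed.

(** * The infinite product space *)

Section product_space.
Variable R : realType.
Local Notation Om := (sample_space R).

Lemma measurable_coord k : measurable_fun [set: Om] (fun w : Om => w k).
Proof.
by move=> _ A mA; rewrite setTI; apply: sub_sigma_algebra; exists k, A.
Qed.

Definition left_shift (w : Om) : Om := fun n => w n.+1.

Lemma measurable_left_shift : measurable_fun [set: Om] left_shift.
Proof.
apply: (@measurability _ _ Om Om setT left_shift (@cylinder_sets R)) => //.
move=> _ [_ [k [B [mB ->]]] <-].
rewrite setTI; apply: sub_sigma_algebra.
by exists k.+1, B.
Qed.

Definition rectangle (n : nat) (A : nat -> set R) : set Om :=
  [set w | forall k, (k < n)%N -> A k (w k)].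

(** A pi-system that generates the product sigma-algebra; [is_product_measure] prescribes [Q] on its
    members. *)
Definition rectangles : set (set Om) :=
  [set X | exists n A, (forall k, measurable (A k)) /\ X = rectangle n A].

Lemma measurable_rectangle n A : (forall k, measurable (A k)) ->
  measurable (rectangle n A).
Proof.
move=> mA; have -> : rectangle n A = \bigcap_(k in `I_n) [set w : Om | A k (w k)].
  by apply/seteqP; split.
apply: bigcap_measurableType => k _; apply: sub_sigma_algebra.
by exists k, (A k).
Qed.

Lemma rectangles_setI : setI_closed rectangles.
Proof.
move=> _ _ [n [A [mA ->]]] [m [B [mB ->]]].
exists (maxn n m), (fun k => (if (k < n)%N then A k else setT) `&`
  (if (k < m)%N then B k else setT)); split.
  by move=> k; apply: measurableI; case: ifP.
apply/seteqP; split => [w [Aw Bw] k _|w ABw].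
  by split; case: ifPn => // ?; [exact: Aw|exact: Bw].
by split=> k km; have := ABw k; rewrite leq_max km ?orbT => /(_ isT)[].
Qed.

Lemma sigma_rectangles : @measurable _ Om = <<s rectangles >>.
Proof.
apply/seteqP; split.
  apply: smallest_sub; first exact: smallest_sigma_algebra.
  move=> _ [k [B [mB ->]]]; apply: sub_sigma_algebra.
  exists k.+1, (fun i => if i == k then B else setT); split.
    by move=> i; case: ifP.
  apply/seteqP; split => [w Bw i _|w]; first by case: eqP => // ->.
  by move=> /(_ k (ltnSn _)); rewrite eqxx.
apply: smallest_sub; first exact: sigma_algebra_measurable.
by move=> _ [n [A [mA ->]]]; exact: measurable_rectangle.
Qed.

Variables (P : probability R R) (Q : probability Om R).
Hypothesis PQ : is_product_measure P Q.

(** Uniqueness of measures on the pi-system of rectangles: the preimage of a rectangle under the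
    shift is a rectangle one longer whose first side is the whole line, which contributes a factor
    1. *)
Lemma shift_invariant (X : set Om) : measurable X -> Q (left_shift @^-1` X) = Q X.
Proof.
move=> mX.
apply: (measure_unique rectangles (fun=> setT) sigma_rectangles rectangles_setI
   _ _ (pushforward Q left_shift) Q) => //.
- move=> _; exists 0%N, (fun=> setT); split => //.
  by apply/seteqP; split.
- by apply/seteqP; split => // x _; exists 0%N.
- exact: measurable_left_shift.
- move=> ms _ [n [A [mA ->]]].
  rewrite /pushforward [RHS]PQ//.
  transitivity (Q (rectangle n.+1 (fun k => if k is k'.+1 then A k' else setT))).
    congr (Q _); apply/seteqP; split => w /= h; first by case.
    by move=> k kn; exact: (h k.+1).
  rewrite [LHS]PQ; last by case.
  by rewrite big_ord_recl/= probability_setT mul1e.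
- move=> ms _; apply: (@le_lt_trans _ _ 1%E); last exact: ltry.
  exact: (probability_le1 Q (@measurableT _ Om)).
Qed.

Lemma coord_law k (B : set R) : measurable B ->
  Q [set w : Om | B (w k)] = P B.
Proof.
move=> mB.
transitivity (Q (rectangle k.+1 (fun i => if i == k then B else setT))).
  congr (Q _); apply/seteqP; split => [w Bw i _|w]; first by case: eqP => // ->.
  by move=> /(_ k (ltnSn _)); rewrite eqxx.
rewrite [LHS]PQ; last by move=> i; case: ifP.
rewrite big_ord_recr/= eqxx big1 ?mul1e// => i _.
by rewrite ltn_eqF ?probability_setT.
Qed.

(** The event is a rectangle of length [(maxn i j).+1] whose other sides are full. This is the
    pairwise independence behind the second-moment bounds. *)
Lemma coord_pair_law i j (A B : set R) : i != j -> measurable A -> measurable B ->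
  Q [set w : Om | A (w i) /\ B (w j)] = (P A * P B)%E.
Proof.
move=> ij mA mB.
pose C k := if k == i then A else if k == j then B else setT.
have mC k : measurable (C k) by rewrite /C; case: ifP => // _; case: ifP.
have jm : (j < (maxn i j).+1)%N by rewrite ltnS leq_maxr.
have im : (i < (maxn i j).+1)%N by rewrite ltnS leq_maxl.
transitivity (Q (rectangle (maxn i j).+1 C)).
  congr (Q _); apply/seteqP; split => [w [Aw Bw] k _|w h].
    by rewrite /C; case: eqP => [->//|_]; case: eqP => // ->.
  split.
    by have := h i; rewrite /C eqxx; apply.
  by have := h j; rewrite /C eqxx eq_sym (negbTE ij); apply.
rewrite [LHS]PQ// (bigD1 (Ordinal im))//= (bigD1 (Ordinal jm))/=; last first.
  by rewrite -val_eqE/= eq_sym.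
rewrite big1 ?mule1.
  by rewrite /C !eqxx eq_sym (negbTE ij).
move=> k /andP[ki kj]; rewrite /C -!val_eqE/= in ki kj *.
by rewrite (negbTE ki) (negbTE kj) probability_setT.
Qed.

Local Open Scope ereal_scope.

Lemma ge0_integral_shift (h : Om -> \bar R) : measurable_fun setT h ->
  (forall w, 0 <= h w) -> \int[Q]_w h (left_shift w) = \int[Q]_w h w.
Proof.
move=> mh h0.
have := ge0_integral_pushforward measurable_left_shift Q measurableT mh
  (fun y _ => h0 y).
rewrite preimage_setT => <-; apply: eq_measure_integral.
  exact: measurable_left_shift.
move=> ms A mA _; exact: shift_invariant.
Qed.

Lemma ge0_integral_coord k (h : R -> \bar R) : measurable_fun setT h ->
  (forall x, 0 <= h x) -> \int[Q]_w h (w k) = \int[P]_x h x.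
Proof.
move=> mh h0.
have := ge0_integral_pushforward (measurable_coord k) Q measurableT mh
  (fun y _ => h0 y).
rewrite preimage_setT => <-; apply: eq_measure_integral.
  exact: measurable_coord.
move=> mk A mA _; exact: coord_law.
Qed.

End product_space.

(** * The strong law of large numbers *)

Definition average (R : realType) (g : R -> R) (n : nat) (w : nat -> R) : R :=
  n%:R^-1 * \sum_(k < n) g (w k).

Lemma bounded_integrable d (T : measurableType d) (R : realType)
    (mu : {measure set T -> \bar R}) (h : T -> R) (b : R) :
  (mu setT < +oo)%E -> measurable_fun setT h -> (forall x, `|h x| <= b) ->
  mu.-integrable setT (EFin \o h).
Proof.
move=> muT mh hb; apply: measurable_bounded_integrable => //.
exists b; split; first exact: num_real.
by move=> M bM x _; exact: le_trans (hb x) (ltW bM).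
Qed.

Lemma probability_ltoo d (T : measurableType d) (R : realType)
  (mu : probability T R) : (mu setT < +oo)%E.
Proof. by rewrite probability_setT ltry. Qed.

(* On [sample_space R] the [Filter] instance that [filterS] and [ae_foralln] need
   is not inferred, hence these restatements over an abstract [T]. *)
Section almost_everywhere_probability.
Variables (d : measure_display) (T : measurableType d) (R : realType).
Variable mu : probability T R.

Lemma ae_imply (A B : T -> Prop) : (forall w, A w -> B w) ->
  {ae mu, forall w, A w} -> {ae mu, forall w, B w}.
Proof. by move=> AB; apply: filterS => w; exact: AB. Qed.

Lemma ae_and (A B : T -> Prop) : {ae mu, forall w, A w} ->
  {ae mu, forall w, B w} -> {ae mu, forall w, A w /\ B w}.
Proof. by apply: filterS2 => w Aw Bw. Qed.

Lemma ae_forall_nat (A : nat -> T -> Prop) :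
  (forall n, {ae mu, forall w, A n w}) -> {ae mu, forall w, forall n, A n w}.
Proof. exact: ae_foralln. Qed.

End almost_everywhere_probability.

(** * The strong law for bounded centred functions *)

Section bounded_strong_law.
Variables (R : realType) (P : probability R R).
Variable Q : probability (sample_space R) R.
Hypothesis PQ : is_product_measure P Q.
Local Notation Om := (sample_space R).
Variables (g : R -> R) (c : R).
Hypothesis mg : measurable_fun setT g.
Hypothesis gc : forall x, `|g x| <= c.
Hypothesis Eg : (\int[P]_x (g x)%:E = 0)%E.

Let c0 : 0 <= c. Proof. exact: le_trans (gc 0). Qed.

Let mgk k : measurable_fun [set: Om] (fun w : Om => g (w k)).
Proof. exact: (measurableT_comp mg (measurable_coord k)). Qed.

Let gij i j (w : Om) : `|g (w i) * g (w j)| <= c * c.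
Proof. by rewrite normrM ler_pM. Qed.

Let mgij i j : measurable_fun [set: Om] (fun w : Om => g (w i) * g (w j)).
Proof. exact: measurable_funM. Qed.

(** By [coord_pair_law] and uniqueness of the product measure, [(w i, w j)] has law [P \x P]; Fubini
    then factors out the vanishing mean of [g]. *)
Lemma integral_coord_mul_eq0 i j : i != j ->
  (\int[Q]_w (g (w i) * g (w j))%:E = 0)%E.
Proof.
move=> ij; pose phi (w : Om) := (w i, w j).
have mphi : measurable_fun setT phi.
  by apply/measurable_fun_pair; exact: measurable_coord.
pose h (z : R * R) := (g z.1 * g z.2)%:E.
have mh : measurable_fun setT h.
  apply/measurable_EFinP; apply: measurable_funM.
    exact: (measurableT_comp mg measurable_fst).
  exact: (measurableT_comp mg measurable_snd).
have /= := @integral_pushforward _ _ _ _ R phi mphi Q setT h mh _ measurableT.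
rewrite preimage_setT => <-; last first.
  exact: (bounded_integrable (probability_ltoo Q) (mgij i j) (gij i j)).
transitivity (\int[P \x P]_z h z)%E.
  apply: eq_measure_integral => A mA _; apply: esym.
  refine (product_measure_unique (m' := pushforward Q phi) _ mA).
  by move=> B C mB mC; exact: coord_pair_law.
rewrite -integral12_prod_meas1; last first.
  apply: (bounded_integrable (b := c * c)).
  - have PPT : (P \x P)%E (setT `*` setT) = (P setT * P setT)%E.
      exact: product_measure1E.
    apply: (@le_lt_trans _ _ ((P \x P)%E (setT `*` setT))).
      by rewrite setXTT.
    by rewrite PPT probability_setT mule1 ltry.
  - exact/measurable_EFinP.
  - by move=> z; rewrite normrM ler_pM.
rewrite /fubini_F /h; under eq_integral => x _.
  under eq_integral do rewrite EFinM/=.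
  rewrite integralZl//; last exact: (bounded_integrable (probability_ltoo P) mg gc).
  by rewrite Eg mule0; over.
by rewrite integral0.
Qed.

(** After expanding the square, off-diagonal terms integrate to 0 and each of the [n] diagonal terms
    to at most [c ^+ 2]. *)
Lemma integral_sum_coord_sqr n :
  (\int[Q]_w ((\sum_(k < n) g (w k)) ^+ 2)%:E <= (n%:R * c ^+ 2)%:E)%E.
Proof.
rewrite (_ : (fun w => _) =
    (fun w : Om => \sum_(i < n) \sum_(j < n) (g (w i) * g (w j))%:E)%E); last first.
  apply/funext => w; rewrite expr2 mulr_suml -sumEFin; apply: eq_bigr => i _.
  by rewrite mulr_sumr -sumEFin.
have intg i j : Q.-integrable setT (fun w : Om => (g (w i) * g (w j))%:E).
  exact: (bounded_integrable (probability_ltoo Q) (mgij i j) (gij i j)).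
rewrite integral_sum//; last first.
  by move=> i; apply: integrable_sum.
rewrite -[leRHS](_ : (\sum_(i < n) (c ^+ 2)%:E)%E = _); last first.
  by rewrite sumEFin sumr_const card_ord mulr_natl.
apply: lee_sum => i _; rewrite integral_sum//.
rewrite (bigD1 i)//= [X in (_ + X)%E]big1 ?adde0; last first.
  by move=> j ji; apply: integral_coord_mul_eq0; rewrite eq_sym.
apply: (@le_trans _ _ (\int[Q]_w (cst (c ^+ 2)%:E w))%E).
  apply: ge0_le_integral => //.
  - by move=> w _; rewrite lee_fin -expr2 sqr_ge0.
  - by apply/measurable_EFinP.
  - by move=> w _; rewrite lee_fin (le_trans (ler_norm _))// expr2.
by rewrite integral_cst//= probability_setT mule1.
Qed.

Lemma integral_average_sqr n : (0 < n)%N ->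
  (\int[Q]_w ((average g n w) ^+ 2)%:E <= (c ^+ 2 / n%:R)%:E)%E.
Proof.
move=> n0.
under eq_integral do rewrite /average exprMn EFinM.
rewrite ge0_integralZl_EFin ?sqr_ge0//; last 2 first.
- by move=> w _; rewrite lee_fin sqr_ge0.
- apply/measurable_EFinP; apply: measurable_funX.
  exact: measurable_sum.
apply: (@le_trans _ _ ((n%:R^-1 ^+ 2)%:E * (n%:R * c ^+ 2)%:E)%E).
  by rewrite lee_wpmul2l ?lee_fin ?sqr_ge0// integral_sum_coord_sqr.
rewrite -EFinM lee_fin le_eqVlt; apply/orP; left; apply/eqP.
by field; rewrite pnatr_eq0 -lt0n.
Qed.

Lemma sum_invr_sqr_le2 n : \sum_(k < n) k.+1%:R ^- 2 <= 2 :> R.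
Proof.
(* The bound is sharpened by [2 / n.+1%:R] so that the induction closes. *)
suff : \sum_(k < n) k.+1%:R ^- 2 <= 2 - 2 / n.+1%:R :> R.
  by move=> /le_trans; apply; rewrite gerBl divr_ge0.
elim: n => [|n IHn]; first by rewrite big_ord0 divr1 subrr.
rewrite big_ord_recr/= (le_trans (lerD IHn (lexx _)))//.
rewrite -subr_ge0 (_ : _ - _ = n%:R / (n.+1%:R ^+ 2 * n.+2%:R)).
  by rewrite divr_ge0// mulr_ge0// sqr_ge0.
rewrite -[n.+2%:R]natr1 -[n.+1%:R]natr1; field.
by rewrite !natr1 !pnatr_eq0.
Qed.

(** Along squares the second moments are bounded by [c ^+ 2 / k.+1%:R ^+ 2], which is summable.
    Hence the series of squared averages has a finite integral, converges almost surely, and its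
    terms tend to 0. *)
Lemma ae_average_sqr_index_cvg0 :
  {ae Q, forall w, average g (k.+1 ^ 2)%N w @[k --> \oo] --> (0 : R)}.
Proof.
pose u k (w : Om) := ((average g (k.+1 ^ 2)%N w) ^+ 2)%:E.
have u0 k w : (0 <= u k w)%E by rewrite lee_fin sqr_ge0.
have mu k : measurable_fun setT (u k).
  apply/measurable_EFinP; apply: measurable_funX.
  by apply: measurable_funM => //; exact: measurable_sum.
have mF : measurable_fun setT (fun w => \sum_(0 <= k <oo) u k w)%E.
  exact: ge0_emeasurable_sum.
have IF : (\int[Q]_w (\sum_(0 <= k <oo) u k w) < +oo)%E.
  rewrite integral_nneseries//.
  apply: (@le_lt_trans _ _ (c ^+ 2 * 2)%:E); last exact: ltry.
  apply: lime_le.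
    by apply: is_cvg_nneseries => k _ _; exact: integral_ge0.
  apply: nearW => n.
  apply: (@le_trans _ _ (\sum_(0 <= k < n) (c ^+ 2 * k.+1%:R ^- 2)%:E)%E).
    apply: lee_sum => k _; apply: (le_trans (integral_average_sqr _)) => //.
    by rewrite natrX.
  rewrite sumEFin lee_fin -mulr_sumr big_mkord ler_wpM2l ?sqr_ge0//.
  exact: sum_invr_sqr_le2.
have iF : Q.-integrable setT (fun w => \sum_(0 <= k <oo) u k w)%E.
  apply/integrableP; split=> //.
  by under eq_integral do rewrite gee0_abs ?nneseries_ge0//.
have [N [mN QN NF]] := integrable_ae measurableT iF.
exists N; split => // w /= nw; apply: NF => /= /(_ Logic.I) Fw; apply: nw.
pose v k := (average g (k.+1 ^ 2)%N w) ^+ 2.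
have v0 k : 0 <= v k by exact: sqr_ge0.
have cv : cvgn (series v).
  apply: nondecreasing_is_cvgn.
    by apply/nondecreasing_seqP => n; rewrite /series/= big_nat_recr//= lerDl.
  exists (fine (\sum_(0 <= k <oo) u k w)%E) => _ [n _ <-].
  rewrite -lee_fin fineK// /series/= -sumEFin.
  by apply: nneseries_lim_ge => k _ _; exact: u0.
have v_cvg0 := cvg_series_cvg_0 cv.
apply/cvgrPdist_lt => e e0.
move/cvgrPdist_lt : v_cvg0 => /(_ _ (exprn_gt0 2 e0)); apply: filterS => k.
rewrite !sub0r !normrN /v ger0_norm ?sqr_ge0// -[ltLHS]real_normK ?num_real//.
by rewrite ltr_pXn2r ?nnegrE// ltW.
Qed.

Lemma nat_sqrt_bounds n : exists k, (k ^ 2 <= n < k.+1 ^ 2)%N.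
Proof.
elim: n => [|n [k /andP[kn nk]]]; first by exists 0%N.
have [nk'|nk'] := ltnP n.+1 (k.+1 ^ 2)%N.
  by exists k; rewrite nk' (leq_trans kn).
exists k.+1; rewrite nk'/=; have -> : n.+1 = (k.+1 ^ 2)%N.
  by apply/eqP; rewrite eqn_leq nk nk'.
by rewrite ltn_exp2r.
Qed.

(** At most [2 * k] terms separate [k ^ 2] from [n], each at most [c] in absolute value; dividing by
    [n >= k ^ 2] leaves an error of [c * 2 / k]. *)
Lemma average_interpolation k n (w : nat -> R) : (0 < k)%N ->
  (k ^ 2 <= n < k.+1 ^ 2)%N ->
  `|average g n w| <= `|average g (k ^ 2)%N w| + c * 2 / k%:R.
Proof.
move=> k0 /andP[kn nk].
have k2 : (0 < k ^ 2)%N by rewrite expn_gt0 k0.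
have n0 : (0 < n)%N by exact: leq_trans kn.
have S_le : `|\sum_(i < n) g (w i)| <=
    `|\sum_(i < k ^ 2) g (w i)| + c * (2 * k%:R).
  rewrite -(big_mkord xpredT (g \o w)) -(big_mkord xpredT (g \o w))/=.
  rewrite (@big_cat_nat _ _ _ (k ^ 2)%N)//= (le_trans (ler_normD _ _))// lerD2l.
  rewrite (le_trans (ler_norm_sum _ _ _))//.
  apply: (@le_trans _ _ (\sum_(k ^ 2 <= i < n) c)); first by apply: ler_sum => i _.
  rewrite sumr_const_nat -[c *+ _]mulr_natr ler_wpM2l// -natrM ler_nat.
  by rewrite leq_subLR; move: nk; rewrite !expnS !expn0; lia.
rewrite /average !normrM !normfV !normr_nat.
apply: (@le_trans _ _
  ((k ^ 2)%:R^-1 * (`|\sum_(i < k ^ 2) g (w i)| + c * (2 * k%:R)))).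
  by rewrite ler_pM ?invr_ge0// lef_pV2 ?posrE ?ltr0n// ler_nat.
rewrite mulrDr lerD2l le_eqVlt; apply/orP; left; apply/eqP.
by rewrite natrX; field; rewrite pnatr_eq0 -lt0n.
Qed.

Lemma bounded_average_cvg0 :
  {ae Q, forall w, average g n w @[n --> \oo] --> (0 : R)}.
Proof.
apply: ae_imply ae_average_sqr_index_cvg0 => w /cvgrPdist_lt wcvg.
apply/cvgrPdist_lt => e e0.
have e20 : 0 < e / 2 by rewrite divr_gt0.
have [K1 _ HK1] := wcvg _ e20.
have : c * 2 * k.+1%:R^-1 @[k --> \oo] --> c * 2 * (0 : R).
  by apply: cvgMr; exact: cvg_harmonic.
rewrite mulr0 => /cvgrPdist_lt/(_ _ e20) [K2 _ HK2].
(* Both limits use index [k] for the base [k.+1], hence the offset: if [k.+1] is the integer square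
   root of [n], then [k] exceeds [K1] and [K2]. *)
exists ((maxn K1 K2).+2 ^ 2)%N => // n /= Kn.
have [k /andP[kn nk]] := nat_sqrt_bounds n.
have : ((maxn K1 K2).+2 ^ 2 < k.+1 ^ 2)%N by exact: leq_ltn_trans nk.
rewrite ltn_exp2r// ltnS; case: k => // k in kn nk *.
rewrite ltnS => Kk; rewrite sub0r normrN.
apply: (le_lt_trans (average_interpolation w _ (introT andP (conj kn nk)))) => //.
rewrite [ltRHS](splitr e) ltrD//.
  have := HK1 k; rewrite /= sub0r normrN; apply.
  by rewrite (leq_trans (leq_maxl K1 K2))// ltnW.
have := HK2 k; rewrite /= sub0r normrN => /(_ _)/(le_lt_trans (ler_norm _)); apply.
by rewrite (leq_trans (leq_maxr K1 K2))// ltnW.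
Qed.

End bounded_strong_law.

(** * Garsia's maximal ergodic inequality *)

Section maximal_ergodic_inequality.
Variables (R : realType) (P : probability R R).
Variable Q : probability (sample_space R) R.
Hypothesis PQ : is_product_measure P Q.
Local Notation Om := (sample_space R).
Variables (h : R -> R) (l : R).
Hypothesis mh : measurable_fun setT h.
Hypothesis h0 : forall x, 0 <= h x.
Hypothesis ih : (\int[P]_x (h x)%:E < +oo)%E.
Hypothesis l0 : 0 <= l.

(* [max_sum n w] is the maximum of the partial sums of order at most [n] of
   [h (w k) - l], the empty sum included. *)
Fixpoint max_sum (n : nat) (w : Om) : R :=
  if n is n'.+1 then Num.max 0 (h (w 0%N) - l + max_sum n' (left_shift w)) else 0.

Lemma max_sum_ge0 n (w : Om) : 0 <= max_sum n w.
Proof. by case: n => //= n; rewrite le_max lexx. Qed.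

Lemma le_max_sumS n (w : Om) : max_sum n w <= max_sum n.+1 w.
Proof.
elim: n w => [|n IHn] w; first exact: max_sum_ge0.
by rewrite /= ge_max !le_max lexx/= lerD2l IHn orbT.
Qed.

Lemma le_max_sum n (w : Om) : \sum_(k < n) (h (w k) - l) <= max_sum n w.
Proof.
elim: n w => [|n IHn] w; first by rewrite big_ord0.
by rewrite big_ord_recl/= le_max lerD2l (IHn (left_shift w)) orbT.
Qed.

Lemma measurable_max_sum n : measurable_fun setT (max_sum n).
Proof.
elim: n => [|n IHn]; first exact: measurable_cst.
apply: measurable_maxr; first exact: measurable_cst.
apply: measurable_funD.
  apply: measurable_funB; last exact: measurable_cst.
  exact: (measurableT_comp mh (measurable_coord 0)).
exact: (measurableT_comp IHn (@measurable_left_shift R)).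
Qed.

Let mhk k : measurable_fun [set: Om] (fun w : Om => (h (w k))%:E).
Proof.
by apply/measurable_EFinP; exact: (measurableT_comp mh (measurable_coord k)).
Qed.

Let mM n : measurable_fun [set: Om] (fun w => (max_sum n w)%:E).
Proof. by apply/measurable_EFinP; exact: measurable_max_sum. Qed.

Let mMs n : measurable_fun [set: Om] (fun w => (max_sum n (left_shift w))%:E).
Proof. exact: (measurableT_comp (mM n) (@measurable_left_shift R)). Qed.

Let Ehk k : (\int[Q]_w (h (w k))%:E = \int[P]_x (h x)%:E)%E.
Proof.
apply: (ge0_integral_coord PQ k (h := EFin \o h)).
  exact/measurable_EFinP.
by move=> x; rewrite lee_fin.
Qed.

Let EMs n : (\int[Q]_w (max_sum n (left_shift w))%:E = \int[Q]_w (max_sum n w)%:E)%E.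
Proof.
apply: (ge0_integral_shift PQ (h := EFin \o max_sum n)); first exact: mM.
by move=> w; rewrite lee_fin max_sum_ge0.
Qed.

(** Finiteness is what permits cancelling the integral of [max_sum] later. As [l >= 0], one
    recursion step adds at most [h (w 0)], and the shift preserves the integral. *)
Lemma integral_max_sum_ltoo n : (\int[Q]_w (max_sum n w)%:E < +oo)%E.
Proof.
elim: n => [|n IHn]; first by rewrite integral0 ltry.
apply: (@le_lt_trans _ _ (\int[P]_x (h x)%:E + \int[Q]_w (max_sum n w)%:E)%E).
  rewrite -(Ehk 0) -(EMs n) -ge0_integralD//; last 2 first.
  - by move=> w _; rewrite lee_fin.
  - by move=> w _; rewrite lee_fin max_sum_ge0.
  apply: ge0_le_integral => //.
  - by move=> w _; rewrite lee_fin max_sum_ge0.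
  - exact: emeasurable_funD.
  - move=> w _; rewrite -EFinD lee_fin /= ge_max addr_ge0 ?max_sum_ge0//=.
    by rewrite lerD2r gerBl.
exact: lte_add_pinfty.
Qed.

Let A n : set Om := [set w | 0 < max_sum n w].

Let mA n : measurable (A n).
Proof.
rewrite -[A n]setTI.
exact: (measurable_lte measurableT (measurable_cst 0%:E) (mM n)).
Qed.

(* [max_sum n w <= h (w 0) - l + max_sum n (left_shift w)] where
   [0 < max_sum n w]; after integration the two occurrences of [max_sum] cancel by
   shift invariance. *)
Lemma max_sum_gt0_bound n : (l%:E * Q (A n) <= \int[P]_x (h x)%:E)%E.
Proof.
have QA : Q (A n) = (\int[Q]_w (\1_(A n) w)%:E)%E.
  by rewrite integral_indic// setIT.
rewrite -(@leeD2rE _ (\int[Q]_w (max_sum n w)%:E)%E); last first.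
  rewrite ge0_fin_numE ?integral_max_sum_ltoo//.
  by apply: integral_ge0 => w _; rewrite lee_fin max_sum_ge0.
rewrite -{2}(EMs n) -(Ehk 0) QA.
rewrite -ge0_integralZl_EFin//; last first.
  by apply/measurable_EFinP; exact: measurable_indic.
rewrite -!ge0_integralD//.
- apply: ge0_le_integral => //.
  + move=> w _; rewrite -EFinM -EFinD lee_fin addr_ge0 ?max_sum_ge0//.
    by rewrite mulr_ge0.
  + apply: emeasurable_funD => //; apply/measurable_EFinP.
    by apply: measurable_funM => //; exact: measurable_indic.
  + exact: emeasurable_funD.
  + move=> w _; rewrite -EFinM -!EFinD lee_fin indicE.
    have [wA|wA] := boolP (w \in A n); last first.
      rewrite mulr0 add0r; have : ~~ (0 < max_sum n w).
        by apply: contra wA => M0; rewrite inE.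
      rewrite -leNgt => /le_trans; apply.
      by rewrite addr_ge0 ?max_sum_ge0.
    rewrite mulr1; move: wA; rewrite inE /A/=.
    case: n {QA} => [|n]; first by rewrite ltxx.
    move=> M0; have M0' : 0 < h (w 0%N) - l + max_sum n (left_shift w).
      by move: M0; rewrite /= lt_max ltxx.
    have -> : max_sum n.+1 w = h (w 0%N) - l + max_sum n (left_shift w).
      exact: max_idPr (ltW M0').
    (* The recursion produces [max_sum n] at the shifted point, one order short of the right-hand
       side; monotonicity in the order closes the gap. *)
    rewrite addrA subrKC lerD2l; exact: le_max_sumS.
- by move=> w _; rewrite lee_fin.
- by move=> w _; rewrite lee_fin max_sum_ge0.
- by move=> w _; rewrite -EFinM lee_fin mulr_ge0.
- by apply/measurable_EFinP/measurable_funM => //; exact: measurable_indic.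
- by move=> w _; rewrite lee_fin max_sum_ge0.
Qed.

(** [B] is the union of the increasing events [A n], so continuity from below carries the bound
    over. Outside [B] no partial sum of [h - l] is positive. *)
Lemma maximal_ergodic_inequality : exists B : set Om, [/\ measurable B,
  (l%:E * Q B <= \int[P]_x (h x)%:E)%E &
  forall w, ~ B w -> forall n, average h n w <= l].
Proof.
have mU : measurable (\bigcup_n A n) by exact: bigcupT_measurable.
exists (\bigcup_n A n); split => //.
  have ndA : nondecreasing_seq A.
    apply/nondecreasing_seqP => n; apply/subsetPset => w /= M0.
    exact: lt_le_trans (le_max_sumS n w).
  have cvA := @nondecreasing_cvg_mu _ _ _ Q A mA mU ndA.
  have cvlA := cvgeZl (isT : l%:E \is a fin_num) cvA.
  rewrite -(cvg_lim _ cvlA)//; apply: lime_le.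
    by apply/cvg_ex; eexists; exact: cvlA.
  by apply: nearW => n; exact: max_sum_gt0_bound.
(* The average of order 0 is 0, so this case is [0 <= l]. *)
move=> w Uw [|n]; first by rewrite /average big_ord0 mulr0.
rewrite /average mulrC ler_pdivrMr ?ltr0n// leNgt; apply/negP => lS; apply: Uw.
exists n.+1 => //=; apply: lt_le_trans (le_max_sum n.+1 w).
by rewrite sumrB subr_gt0 sumr_const card_ord -mulr_natr.
Qed.

End maximal_ergodic_inequality.

(** * Truncation and elementary facts on averages *)

Lemma dist_lt_thirds (R : realFieldType) (a b c d e : R) :
  `|a - b| < e / 3 -> `|b - c| < e / 3 -> `|c - d| < e / 3 -> `|a - d| < e.
Proof.
by rewrite !ltr_norml => /andP[? ?] /andP[? ?] /andP[? ?]; apply/andP; split; lra.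
Qed.

Lemma ex_harmonic_lt (R : realType) (e : R) : 0 < e ->
  exists n : nat, n.+1%:R^-1 < e.
Proof.
move=> e0; have := @cvg_harmonic R => /cvgrPdist_lt/(_ _ e0)[n _ Hn].
by exists n; have := Hn n (leqnn _); rewrite /= sub0r normrN ger0_norm.
Qed.

(** Replacing [f] by 0 where [|f| > n] gives functions dominated by [|f|] that are eventually equal
    to [f] at each point; dominated convergence yields convergence in L1. *)
Lemma bounded_L1_approximation d (T : measurableType d) (R : realType)
    (mu : {measure set T -> \bar R}) (f : T -> R) (e : R) :
  measurable_fun setT f -> mu.-integrable setT (EFin \o f) -> 0 < e ->
  exists (t : T -> R) (b : R), [/\ measurable_fun setT t, forall x, `|t x| <= b &
    (\int[mu]_x (`|t x - f x|)%:E <= e%:E)%E].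
Proof.
move=> mf intf e0.
pose t (n : nat) x := if `|f x| <= n%:R then f x else 0.
have mt n : measurable_fun setT (t n).
  apply: measurable_fun_ifT => //.
  apply: measurable_fun_ler => //; exact: measurableT_comp.
have tf x : t n x @[n --> \oo] --> f x.
  apply: cvg_near_cst; exists (Num.truncn `|f x|).+1 => // n /= fn.
  by rewrite /t ifT// (le_trans (ltW (truncnS_gt _)))// ler_nat.
have := @dominated_convergence _ _ _ mu setT measurableT
  (fun n => EFin \o t n) (EFin \o f) (fun x => (`|f x|)%:E).
case.
- by move=> n; exact/measurable_EFinP.
- exact/measurable_EFinP.
- by apply: aeW => x _; apply/fine_cvgP; split; [exact: nearW|exact: tf].
- exact: (integrable_abse intf).
- apply: aeW => x n _ /=; rewrite lee_fin /t.
  by case: ifP; rewrite ?normr0.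
move=> _ /fine_cvgP [fin_t /cvgrPdist_lt/(_ _ e0) small_t] _.
have [n _ /(_ n (leqnn _)) [finn smalln]] := filterI fin_t small_t.
exists (t n), n%:R; split => //.
  by move=> x; rewrite /t; case: ifPn => //; rewrite normr0.
rewrite -[leLHS](fineK finn) lee_fin (le_trans (ler_norm _))// ltW//.
by move: smalln; rewrite sub0r normrN.
Qed.

Lemma average_add (R : realType) (f g : R -> R) n w :
  average (f \+ g) n w = average f n w + average g n w.
Proof. by rewrite /average -mulrDr -big_split. Qed.

Lemma average_cst (R : realType) (c : R) n w : (0 < n)%N ->
  average (cst c) n w = c.
Proof.
move=> n0; rewrite /average sumr_const card_ord -[c *+ _]mulr_natr mulrC mulfK//.
by rewrite pnatr_eq0 -lt0n.
Qed.

Lemma le_norm_average (R : realType) (f g : R -> R) n w :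
  (forall x, `|f x| <= g x) -> `|average f n w| <= average g n w.
Proof.
move=> fg; rewrite /average normrM normfV normr_nat ler_wpM2l ?invr_ge0//.
by rewrite (le_trans (ler_norm_sum _ _ _))// ler_sum.
Qed.

(** * The strong law for integrable functions *)

Section strong_law.
Variables (R : realType) (P : probability R R).
Variable Q : probability (sample_space R) R.
Hypothesis PQ : is_product_measure P Q.
Local Notation Om := (sample_space R).

Lemma bounded_strong_law (t : R -> R) (b : R) :
  measurable_fun setT t -> (forall x, `|t x| <= b) ->
  {ae Q, forall w, average t n w @[n --> \oo] --> \int[P]_x t x}.
Proof.
move=> mt tb; have it := bounded_integrable (probability_ltoo P) mt tb.
pose m := \int[P]_x t x; pose g := t \- cst m.
have mg : measurable_fun setT g by exact: measurable_funB.
have gb x : `|g x| <= b + `|m| by rewrite (le_trans (ler_normB _ _))// lerD2r.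
have Eg : (\int[P]_x (g x)%:E = 0)%E.
  have ic := finite_measure_integrable_cst P m measurableT.
  under eq_integral do rewrite /g/= EFinB.
  rewrite integralB// integral_cst//= probability_setT mule1.
  rewrite /m /Rintegral fineK ?subee//.
    exact: integrable_fin_num.
  exact: integrable_fin_num.
apply: ae_imply (bounded_average_cvg0 PQ mg gb Eg) => w gw.
rewrite -/m -[X in _ --> X]add0r.
have : average g n w + m @[n --> \oo] --> 0 + m by apply: cvgD => //; exact: cvg_cst.
(* The average of order 0 is 0 for every function, so the identity is claimed from [n = 1] on. *)
apply: cvg_trans; apply: near_eq_cvg; exists 1%N => // n /= n0.
rewrite -[in LHS](average_cst m w n0) -average_add; congr average.
by apply/funext => x; rewrite /g/= subrK.
Qed.

(** The maximal inequality bounds the exceptional set of index [i] by [i.+1%:R^-1 / l], so the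
    exceptional sets of index at least [j] have a null intersection. Outside it one index serves all
    [n] at once. *)
Lemma ae_average_le (h : nat -> R -> R) (l : R) :
  (forall i, measurable_fun setT (h i)) -> (forall i x, 0 <= h i x) ->
  (forall i, (\int[P]_x (h i x)%:E <= (i.+1%:R^-1)%:E)%E) -> 0 < l ->
  forall j, {ae Q, forall w, exists2 i, (j <= i)%N & forall n, average (h i) n w <= l}.
Proof.
move=> mh h0 ih l0 j.
have ih' i : (\int[P]_x (h i x)%:E < +oo)%E.
  by apply: le_lt_trans (ih i) _; rewrite ltry.
have /choice [B HB] : forall i, exists B : set Om, [/\ measurable B,
  (l%:E * Q B <= \int[P]_x (h i x)%:E)%E &
  forall w, ~ B w -> forall n, average (h i) n w <= l].
  by move=> i; exact: (maximal_ergodic_inequality PQ (mh i) (h0 i) (ih' i) (ltW l0)).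
have mN : measurable (\bigcap_i B (j + i)%N).
  by apply: bigcapT_measurable => i; have [] := HB (j + i)%N.
exists (\bigcap_i B (j + i)%N); split => //.
  apply/eqP; rewrite -measure_le0; apply/lee_addgt0Pr => e e0.
  rewrite add0e.
  have [i Hi] := ex_harmonic_lt (mulr_gt0 l0 e0).
  have [mB QB _] := HB (j + i)%N.
  apply: (@le_trans _ _ (Q (B (j + i)%N))).
    by apply: le_measure; rewrite ?inE//; apply: bigcap_inf.
  have QBfin : Q (B (j + i)%N) \is a fin_num by exact: fin_num_measure.
  rewrite -(fineK QBfin) lee_fin -(ler_pM2l l0) -lee_fin EFinM fineK//.
  apply: (le_trans QB); apply: (le_trans (ih _)); rewrite lee_fin.
  rewrite (le_trans _ (ltW Hi))// lef_pV2 ?posrE ?ltr0n// ler_nat ltnS.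
  exact: leq_addl.
move=> w /= nw i _; apply: contrapT => Bw; apply: nw.
by exists (j + i)%N; [exact: leq_addr|have [_ _] := HB (j + i)%N; apply].
Qed.

Theorem strong_law (f : R -> R) :
  measurable_fun setT f -> P.-integrable setT (EFin \o f) ->
  {ae Q, forall w, average f n w @[n --> \oo] --> \int[P]_x f x}.
Proof.
move=> mf intf.
have /choice [t /choice [b tbP]] : forall i : nat, exists (t : R -> R) (b : R),
    [/\ measurable_fun setT t, forall x, `|t x| <= b &
     (\int[P]_x (`|t x - f x|)%:E <= (i.+1%:R^-1)%:E)%E].
  by move=> i; apply: bounded_L1_approximation => //; rewrite invr_gt0.
have mt i : measurable_fun setT (t i) by have [] := tbP i.
have tb i : forall x, `|t i x| <= b i by have [] := tbP i.
have it i : P.-integrable setT (EFin \o t i).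
  exact: bounded_integrable (probability_ltoo P) (mt i) (tb i).
pose h i x := `|t i x - f x|.
have mh i : measurable_fun setT (h i).
  by apply: measurableT_comp => //; exact: measurable_funB.
have ih i : (\int[P]_x (h i x)%:E <= (i.+1%:R^-1)%:E)%E by have [] := tbP i.
have dist_mean i : `|\int[P]_x t i x - \int[P]_x f x| <= i.+1%:R^-1.
  rewrite -RintegralB// (le_trans (le_normr_Rintegral _ _))//.
    exact: (integrableB measurableT (it i) intf).
  rewrite -lee_fin /Rintegral fineK; first exact: ih.
  rewrite ge0_fin_numE; last by apply: integral_ge0 => x _; rewrite lee_fin.
  by apply: le_lt_trans (ih i) _; rewrite ltry.
have H1 : {ae Q, forall w, forall i, average (t i) n w @[n --> \oo] --> \int[P]_x t i x}.
  by apply: ae_forall_nat => i; exact: bounded_strong_law (mt i) (tb i).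
have H2 : {ae Q, forall w, forall j : nat, exists2 i, (j <= i)%N &
    forall n, average (h i) n w <= j.+1%:R^-1}.
  apply: ae_forall_nat => j.
  have j0 : 0 < j.+1%:R^-1 :> R by rewrite invr_gt0.
  exact: (ae_average_le mh (fun i x => normr_ge0 _) ih j0 j).
apply: ae_imply (ae_and H1 H2) => w [H1w H2w].
apply/cvgrPdist_lt => e e0.
have e3 : 0 < e / 3 by rewrite divr_gt0.
(* The level [j] is fixed first; the approximant [i] then depends on [w], which is why both almost
   sure events quantify over all indices. *)
have [j Hj] := ex_harmonic_lt e3.
have [i ji Hi] := H2w j.
have ij : i.+1%:R^-1 <= j.+1%:R^-1 :> R by rewrite lef_pV2 ?posrE ?ltr0n// ler_nat.
have /cvgrPdist_lt/(_ _ e3) := H1w i; apply: filterS => n Hn.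
have Haf : `|average (t i) n w - average f n w| <= j.+1%:R^-1.
  apply: le_trans (Hi n).
  have -> : average (t i) n w - average f n w = average (t i \- f) n w.
    rewrite /average -mulrBr -sumrB//.
  exact: le_norm_average.
have Htf := le_lt_trans (dist_mean i) (le_lt_trans ij Hj).
rewrite distrC in Hn; rewrite distrC in Haf; rewrite distrC.
exact: dist_lt_thirds (le_lt_trans Haf Hj) Hn Htf.
Qed.

End strong_law.

(** * Lipschitz estimate and nets in row vectors *)

Section row_vectors.
Variables (R : realType) (m : nat).
Implicit Types (x v t : 'rV[R]_m) (N : 'rV[R]_m -> R) (g : 'rV[R]_m -> R).

(** The norm of a row vector written with bars is the maximum norm. *)
Lemma le_coord_norm x i : `|x ord0 i| <= `|x|.
Proof.
rewrite [leRHS]/Num.Def.normr /= mx_normrE; apply/bigmax_geP; right => /=.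
by exists (ord0, i).
Qed.

Lemma is_norm0 N : is_norm N -> N 0 = 0.
Proof. by move=> [_ NZ _]; rewrite -(scale0r 0) NZ normr0 mul0r. Qed.

Lemma is_normN N x : is_norm N -> N (- x) = N x.
Proof. by move=> [_ NZ _]; rewrite -scaleN1r NZ normrN1 mul1r. Qed.

(** From [0 = N (x - x) <= N x + N (- x) = 2 * N x]. *)
Lemma is_norm_ge0 N x : is_norm N -> 0 <= N x.
Proof.
move=> normN; have [ND _ _] := normN; have := ND x (- x).
by rewrite subrr is_norm0// is_normN// -mulr2n pmulrn_lge0.
Qed.

Lemma is_norm_sum N (I : finType) (F : I -> 'rV[R]_m) : is_norm N ->
  N (\sum_i F i) <= \sum_i N (F i).
Proof.
move=> normN; have [ND _ _] := normN.
elim/big_ind2 : _ => //; first by rewrite is_norm0.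
by move=> x1 x2 y1 y2 N1 N2; rewrite (le_trans (ND _ _))// lerD.
Qed.

Lemma is_norm_le N x : is_norm N -> N x <= `|x| * \sum_(i < m) N 'e_i.
Proof.
move=> normN; have [_ NZ _] := normN.
rewrite {1}(row_sum_delta x) (le_trans (is_norm_sum _ normN))//.
rewrite mulr_sumr ler_sum// => i _; rewrite NZ ler_wpM2r ?le_coord_norm//.
exact: is_norm_ge0.
Qed.

(** [N] is Lipschitz for the maximum norm, by the reverse triangle inequality and [is_norm_le]. *)
Lemma is_norm_continuous N : is_norm N -> continuous N.
Proof.
move=> normN x; have [ND _ _] := normN.
pose K := \sum_(i < m) N 'e_i + 1.
have K0 : 0 < K.
  by rewrite ltr_wpDl// sumr_ge0// => i _; exact: is_norm_ge0.
have NK y : N y <= `|y| * K.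
  by rewrite (le_trans (is_norm_le y normN))// ler_wpM2l// lerDl.
apply/(@cvgrPdist_lt _ _ _ (nbhs x) (nbhs_filter x)) => e e0.
have eK : 0 < e / K by rewrite divr_gt0.
apply: (@filterS _ (nbhs x) (nbhs_filter x) _ _ _ (nbhsx_ballx x _ eK)) => y.
rewrite -ball_normE/= => xy; rewrite ltr_pdivlMr// in xy.
have := ND (x - y) y; have := ND (y - x) x; rewrite !subrK.
have := NK (x - y); have := NK (y - x); rewrite (distrC y x).
move=> N1 N2 N3 N4; rewrite ltr_norml; apply/andP; split; lra.
Qed.

(** On the compact unit sphere of the maximum norm, [N] attains a minimum, positive by definiteness;
    homogeneity makes its inverse a valid [C]. *)
Lemma is_norm_equiv N : is_norm N ->
  exists2 C, 0 <= C & forall x, `|x| <= C * N x.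
Proof.
move=> normN; have [_ NZ N0] := normN.
pose S := [set x : 'rV[R]_m | `|x| = 1].
(* The minimum needs a nonempty sphere; if the sphere is empty, every vector is 0. *)
have [S0|/set0P S0] := eqVneq S set0.
  exists 0 => // x; rewrite mul0r.
  have [->|x0] := eqVneq x 0; first by rewrite normr0.
  suff : S (`|x|^-1 *: x) by rewrite S0.
  by rewrite /S/= normrZ normfV normr_id mulVf// normr_eq0.
have cS : compact S.
  apply: bounded_closed_compact.
    exists 1; split; first exact: num_real.
    by move=> M M1 x /= ->; exact: ltW.
  have /continuous_closedP := @norm_continuous R 'rV[R]_m.
  by move=> /(_ [set 1]); apply; exact: closed_eq.
have [c Sc cmin] := EVT_min_rV S0 cS
  (continuous_subspaceT (is_norm_continuous normN)).
have c1 : `|c| = 1 by move: Sc; rewrite inE.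
have Nc0 : 0 < N c.
  rewrite lt_neqAle is_norm_ge0// andbT eq_sym; apply/eqP => /N0 c0.
  by move: c1; rewrite c0 normr0 => /esym/eqP; rewrite oner_eq0.
exists (N c)^-1 => [|x]; first by rewrite invr_ge0 ltW.
have [->|x0] := eqVneq x 0.
  by rewrite normr0 mulr_ge0 ?is_norm_ge0// invr_ge0 ltW.
have nx0 : 0 < `|x| by rewrite normr_gt0.
have := cmin (`|x|^-1 *: x); rewrite inE /S/= NZ !normrZ normfV normr_id.
rewrite mulVf ?gt_eqF// => /(_ erefl).
rewrite [X in _ <= X -> _]mulrC ler_pdivlMr// => cx.
by rewrite mulrC ler_pdivlMr// mulrC.
Qed.

(** By linearity in [v], the derivative is a sum of [m] products of coordinates of [v] and of the
    gradient, each at most the product of the maximum norms. *)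
Lemma derive_le_gradient g t v : differentiable g t ->
  `|'D_v g t| <= m%:R * `|v| * `|gradient g t|.
Proof.
move=> dg; rewrite deriveE//.
rewrite {1}(row_sum_delta v) linear_sum (le_trans (ler_norm_sum _ _ _))//.
apply: (@le_trans _ _ (\sum_(i < m) `|v| * `|gradient g t|)).
  apply: ler_sum => i _; rewrite linearZ/= normrM ler_pM ?le_coord_norm//.
  by have := le_coord_norm (gradient g t) i; rewrite mxE deriveE.
by rewrite sumr_const card_ord -[leLHS]mulr_natl mulrA.
Qed.

(** The difference quotients of the restriction to the line at [u] are those of [g] at [t + u *: v]
    in direction [v]. *)
Lemma is_derive_line g t v (u : R) : differentiable g (t + u *: v) ->
  is_derive u 1 (fun h : R => g (t + h *: v)) ('D_v g (t + u *: v)).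
Proof.
move=> dg.
have E : (fun h : R => h^-1 *: (((fun h : R => g (t + h *: v)) \o shift u) (h *: 1) -
     g (t + u *: v))) =
   (fun h : R => h^-1 *: ((g \o shift (t + u *: v)) (h *: v) - g (t + u *: v))).
  apply/funext => h /=; congr (_ *: (g _ - _)).
  by rewrite /shift/= scalerDl [h *: 1]mulr1 addrCA addrC.
have dv : derivable g (t + u *: v) v by exact: diff_derivable.
apply: DeriveDef; first by rewrite /derivable E.
by rewrite /derive E.
Qed.

Lemma mean_value_line g s t (B : R) :
  (forall u : R, 0 <= u <= 1 -> differentiable g (t + u *: (s - t))) ->
  (forall u : R, 0 <= u <= 1 -> `|'D_(s - t) g (t + u *: (s - t))| <= B) ->
  `|g s - g t| <= B.
Proof.
move=> dg gB; pose phi (h : R) := g (t + h *: (s - t)).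
have dphi (u : R) : u \in `[0, 1] ->
    is_derive u 1 phi ('D_(s - t) g (t + u *: (s - t))).
  by rewrite in_itv/= => u01; apply: is_derive_line; exact: dg.
have cphi : {within `[0, 1], continuous phi}.
  apply: derivable_within_continuous => u u01.
  by have [] := dphi u u01.
have dphi' (u : R) : u \in `]0, 1[ ->
    is_derive u 1 phi ('D_(s - t) g (t + u *: (s - t))).
  by move=> u01; apply: dphi; apply: subset_itv_oo_cc u01.
have [c c01] := MVT_segment (@ler01 R) dphi' cphi.
rewrite /phi scale1r scale0r addr0 subrKC subr0 mulr1 => ->.
by apply: gB; move: c01; rewrite in_itv.
Qed.

Lemma convex_hull_segment (T : set 'rV[R]_m) s t (u : R) :
  T s -> T t -> 0 <= u <= 1 -> convex_hull T (t + u *: (s - t)).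
Proof.
move=> Ts Tt /andP[u0 u1] A [cA TA].
have := cA s t (Itv01 u0 u1); rewrite !inE => /(_ (TA _ Ts) (TA _ Tt)).
have -> // : t + u *: (s - t) = u *: s + (1 - u) *: t.
by rewrite scalerBr scalerBl scale1r addrCA.
Qed.

(** The closure of [T] is compact, and balls centred in [T] itself already cover it; a finite
    subcover provides centres that belong to [T]. *)
Lemma finite_net (T : set 'rV[R]_m) (e : R) : bounded_set T -> 0 < e ->
  exists r : seq 'rV[R]_m, (forall t, t \in r -> T t) /\
    forall t, T t -> exists2 s, s \in r & `|t - s| < e.
Proof.
move=> [M [Mreal TM]] e0.
pose B := [set x : 'rV[R]_m | `|x| <= M + 1].
have TB : T `<=` B by move=> x Tx; apply: (TM (M + 1)) => //; rewrite ltrDl.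
have cB : compact B.
  apply: bounded_closed_compact.
    exists (M + 1); split; first exact: num_real.
    by move=> M' MM' x /= /le_trans; apply; exact: ltW.
  have /continuous_closedP := @norm_continuous R 'rV[R]_m.
  by move=> /(_ [set y | y <= M + 1]); apply; exact: closed_le.
have clB : closed B by exact: compact_closed.
have cT : compact (closure T).
  apply: (subclosed_compact (@closed_closure _ T) cB).
  by rewrite (closure_id B).1//; exact: closure_subset.
have : cover_compact (closure T) by rewrite -compact_cover.
move=> /(_ _ T (fun s => ball s e)) [|x|D DT Tcov].
- by move=> s _; exact: ball_open.
- move=> /(_ (ball x e) (nbhsx_ballx _ _ e0)) [y [Ty xy]].
  by exists y => //; exact: ball_sym.
exists (finmap.enum_fset D); split => [t tD|t Tt].
  by have := DT t tD; rewrite inE.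
have [s sD] := Tcov t (subset_closure Tt).
rewrite -ball_normE/= distrC => ts; exists s => //.
Qed.

End row_vectors.

(** * Importance weights and infima *)

Section importance_weights.
Variables (R : realType) (P : probability R R) (p : R -> R).
Hypothesis p_density : is_density P p.
Local Open Scope ereal_scope.

Lemma null_setC_supp : P (~` supp p) = 0.
Proof.
have [mp p0 Pp] := p_density.
have mS : measurable (~` supp p).
  rewrite -[supp p]setTI; apply: measurableC.
  apply: (measurable_lte measurableT (measurable_cst 0%:E) (g := EFin \o p)).
  exact/measurable_EFinP.
rewrite Pp//; apply: integral0_eq => x /negP.
by rewrite -leNgt => px; congr EFin; apply/eqP; rewrite eq_le px p0.
Qed.

(** Both sides become the same Lebesgue integral. The weight is described by a product identity,
    which keeps its meaning where [p] vanishes. *)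
Lemma ge0_integral_transfer (P' : probability R R) (p' : R -> R) (u v : R -> \bar R) :
  is_density P' p' -> measurable_fun setT u -> measurable_fun setT v ->
  (forall x, 0 <= u x) -> (forall x, 0 <= v x) ->
  (forall x, u x * (p x)%:E = v x * (p' x)%:E) ->
  \int[P]_x u x = \int[P']_x v x.
Proof.
move=> P'_density mu mv u0 v0 uv.
rewrite (ge0_integral_density p_density)// (ge0_integral_density P'_density)//.
by apply: eq_integral => x _; rewrite uv.
Qed.

Variables (P' : probability R R) (p' : R -> R) (f g : R -> R).
Hypothesis P'_density : is_density P' p'.
Hypotheses (mf : measurable_fun setT f) (mg : measurable_fun setT g).
Hypothesis gp : forall x, (g x * p x = f x * p' x)%R.

Let p0 x : (0 <= p x)%R. Proof. by have [] := p_density. Qed.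

Let p'0 x : (0 <= p' x)%R. Proof. by have [] := P'_density. Qed.

Lemma integral_abs_transfer :
  \int[P]_x (`|g x|)%:E = \int[P']_x (`|f x|)%:E.
Proof.
apply: (ge0_integral_transfer P'_density).
- by apply/measurable_EFinP; exact: measurableT_comp.
- by apply/measurable_EFinP; exact: measurableT_comp.
- by move=> x; rewrite lee_fin.
- by move=> x; rewrite lee_fin.
- move=> x; rewrite -!EFinM; congr EFin.
  by rewrite -(ger0_norm (p0 x)) -(ger0_norm (p'0 x)) -!normrM gp.
Qed.

(** Multiplication by a nonnegative density commutes with taking positive and negative parts, so the
    identity [gp] passes to each part. *)
Lemma integral_transfer : \int[P]_x (g x)%:E = \int[P']_x (f x)%:E.
Proof.
rewrite [LHS]integralE [RHS]integralE; congr (_ - _).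
- apply: (ge0_integral_transfer P'_density) => //.
  + exact/measurable_funepos/measurable_EFinP.
  + exact/measurable_funepos/measurable_EFinP.
  + move=> x; rewrite !funerpos/= -!EFinM /funrpos; congr EFin.
    by rewrite !maxr_pMl// gp !mul0r.
- apply: (ge0_integral_transfer P'_density) => //.
  + exact/measurable_funeneg/measurable_EFinP.
  + exact/measurable_funeneg/measurable_EFinP.
  + move=> x; rewrite !funerneg/= -!EFinM /funrneg; congr EFin.
    by rewrite !maxr_pMl// !mulNr gp !mul0r.
Qed.

End importance_weights.

(** * Infima and countable dense families *)

Lemma ereal_inf_dist_le (R : realType) (I : Type) (T : set I) (a b : I -> R)
    (r e : R) : T !=set0 ->
  (forall t, T t -> `|a t - b t| <= e) ->
  ereal_inf [set (b t)%:E | t in T] = r%:E ->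
  (`|ereal_inf [set (a t)%:E | t in T] - r%:E| <= e%:E)%E.
Proof.
move=> [t0 Tt0] ab infb.
have le_inf : ((r - e)%:E <= ereal_inf [set (a t)%:E | t in T])%E.
  apply: le_ereal_inf_tmp => _ [t Tt <-].
  have : (r%:E <= (b t)%:E)%E by rewrite -infb; apply: ereal_inf_lbound; exists t.
  by rewrite !lee_fin; have := ab _ Tt; rewrite ler_norml => /andP[? ?] ?; lra.
have inf_le : (ereal_inf [set (a t)%:E | t in T] - e%:E <= r%:E)%E.
  rewrite -infb; apply: le_ereal_inf_tmp => _ [t Tt <-].
  rewrite leeBlDr// -EFinD.
  apply: (@le_trans _ _ (a t)%:E); first by apply: ereal_inf_lbound; exists t.
  by rewrite lee_fin; have := ab _ Tt; rewrite ler_norml => /andP[? ?]; lra.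
(* The two bounds exclude both infinite values of the infimum. *)
move: le_inf inf_le; case: ereal_inf => [x|//|//].
rewrite -!EFinB !lee_fin => ? ?; rewrite ler_norml; apply/andP; split; lra.
Qed.

Lemma cvge0_le_eps (R : realType) (u : nat -> \bar R) :
  (forall n, (0 <= u n)%E) ->
  (forall e : R, 0 < e -> \forall n \near \oo, (u n <= e%:E)%E) ->
  u n @[n --> \oo] --> 0%E.
Proof.
move=> u0 ule; apply/fine_cvgP; split.
  have := ule 1 ltr01; apply: filterS => n un.
  by rewrite ge0_fin_numE// (le_lt_trans un)// ltry.
apply/cvgrPdist_le => e e0; have := ule e e0; apply: filterS => n un.
rewrite sub0r normrN ger0_norm ?fine_ge0// -lee_fin fineK//.
by rewrite ge0_fin_numE// (le_lt_trans un)// ltry.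
Qed.

(** Finite nets of mesh [j.+1%:R^-1] are enumerated together, entry [i] of net [j] at the code of
    [(j, i)]. Each net sits in an initial stretch of the sequence, so finitely many terms suffice
    for all of [T]. *)
Lemma dense_sequence (R : realType) (m : nat) (T : set 'rV[R]_m) :
  T !=set0 -> bounded_set T ->
  exists e : nat -> 'rV[R]_m, (forall k, T (e k)) /\
    forall d, 0 < d -> exists K : nat, forall t, T t ->
      exists2 k, (k < K)%N & `|t - e k| < d.
Proof.
move=> [t0 Tt0] bT.
have /choice [r rP] : forall j : nat, exists r : seq 'rV[R]_m,
   (forall t, t \in r -> T t) /\
    forall t, T t -> exists2 s, s \in r & `|t - s| < j.+1%:R^-1.
  by move=> j; apply: finite_net => //; rewrite invr_gt0.
(* The default [t0] keeps the sequence in [T] where [k] codes no entry of a net. *)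
pose e k := if unpickle k is Some (j, i) then nth t0 (r j) i else t0.
exists e; split => [k|d d0].
  rewrite /e; case: unpickle => // -[j i].
  have [ir|ir] := ltnP i (size (r j)); last by rewrite nth_default.
  by apply: (rP j).1; rewrite mem_nth.
have [j jd] := ex_harmonic_lt d0.
exists (\max_(i < size (r j)) (pickle (j, i : nat))).+1 => t Tt.
have [s sr ts] := (rP j).2 t Tt.
have ir : (index s (r j) < size (r j))%N by rewrite index_mem.
exists (pickle (j, index s (r j))).
  by rewrite ltnS (leq_bigmax (Ordinal ir)).
by rewrite /e pickleK nth_index// (lt_trans ts).
Qed.

Lemma near_forall_lt (K : nat) (A : nat -> nat -> Prop) :
  (forall k, \forall n \near \oo, A k n) ->
  \forall n \near \oo, forall k, (k < K)%N -> A k n.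
Proof.
move=> nearA; elim: K => [|K IHK]; first exact: nearW.
have := nearA K; apply: filterS2 IHK => n AK AKn k.
by rewrite ltnS leq_eqVlt => /orP[/eqP->//|]; exact: AK.
Qed.

(** * Uniform strong law and consistency *)

Lemma dist_average_le (R : realType) (f g h : R -> R) (d : R) n (w : nat -> R) :
  (forall k, `|f (w k) - g (w k)| <= h (w k) * d) ->
  `|average f n w - average g n w| <= average h n w * d.
Proof.
move=> fgh; rewrite /average -mulrBr -sumrB normrM normfV normr_nat -mulrA.
rewrite ler_wpM2l ?invr_ge0// mulr_suml (le_trans (ler_norm_sum _ _ _))//.
by apply: ler_sum => k _; exact: fgh.
Qed.

Section uniform_strong_law.
Variables (R : realType) (P : probability R R).
Variable Q : probability (sample_space R) R.
Hypothesis PQ : is_product_measure P Q.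
Local Notation Om := (sample_space R).
Variables (m : nat) (T : set 'rV[R]_m) (T_neq0 : T !=set0).
(** [S] is a set of full measure on which the weights are Lipschitz in the parameter; in the
    application it is [supp p]. *)
Variables (S : set R) (mS : measurable S) (PS : P (~` S) = 0%E).
Variables (ft : 'rV[R]_m -> R -> R) (G : R -> R).
Hypothesis mft : forall t, T t -> measurable_fun setT (ft t).
Hypothesis ift : forall t, T t -> P.-integrable setT (EFin \o ft t).
Hypothesis mG : measurable_fun setT G.
Hypothesis G0 : forall x, 0 <= G x.
Hypothesis iG : (\int[P]_x (G x)%:E < +oo)%E.
Hypothesis ft_lipschitz : forall s t x, T s -> T t -> S x ->
  `|ft s x - ft t x| <= G x * `|s - t|.

Let mean t := \int[P]_x ft t x.

Let iG' : P.-integrable setT (EFin \o G).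
Proof.
apply/integrableP; split; first exact/measurable_EFinP.
by under eq_integral do rewrite /= ger0_norm//.
Qed.

Let EG := \int[P]_x G x.

Let EG0 : 0 <= EG.
Proof. by apply: Rintegral_ge0 => x _. Qed.

Lemma ae_sample_in : {ae Q, forall w, forall k : nat, S (w k)}.
Proof.
apply: (ae_forall_nat (mu := Q) (A := fun k w => S (w k))) => k.
exists [set w : Om | (~` S) (w k)]; split => //.
  by have := @measurable_coord R k measurableT _ (measurableC mS); rewrite setTI.
by rewrite (coord_law PQ)//; exact: measurableC.
Qed.

(** The Lipschitz bound holds on [S], hence [P]-almost everywhere, and is integrated. *)
Lemma dist_mean_le s t : T s -> T t -> `|mean s - mean t| <= EG * `|s - t|.
Proof.
move=> Ts Tt; rewrite /mean -RintegralB//; [|exact: ift|exact: ift].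
have ist : P.-integrable setT (EFin \o (fun x => ft s x - ft t x)).
  exact: (integrableB measurableT (ift Ts) (ift Tt)).
have mst : measurable_fun setT (fun x => ft s x - ft t x).
  by apply: measurable_funB; exact: mft.
rewrite (le_trans (le_normr_Rintegral _ ist))//.
rewrite mulrC -RintegralZl// -lee_fin /Rintegral !fineK; first last.
- exact: (integrable_fin_num measurableT (integrable_abse ist)).
- exact: (integrable_fin_num measurableT (integrableZl measurableT `|s - t| iG')).
apply: ae_ge0_le_integral => //.
- exact/measurable_EFinP/measurableT_comp.
- by move=> x _; rewrite lee_fin mulr_ge0.
- exact/measurable_EFinP/measurable_funM.
exists (~` S); split => //; first exact: measurableC.
move=> x /= nle Sx; apply: nle => _.
by rewrite lee_fin mulrC; exact: ft_lipschitz.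
Qed.

Variable e : nat -> 'rV[R]_m.
Hypothesis Te : forall k, T (e k).
Hypothesis e_dense : forall d, 0 < d -> exists K : nat, forall t, T t ->
  exists2 k, (k < K)%N & `|t - e k| < d.

(** Eventually the averages of [G] are at most [EG + 1], so with mesh [d / 3 / (EG + 1)] replacing
    [t] by a net point costs less than [d / 3] in the average and again in the mean; the strong law
    at the finitely many net points costs the remaining third. *)
Lemma ae_uniform_average : {ae Q, forall w, forall d, 0 < d ->
  \forall n \near \oo, forall t, T t -> `|average (ft t) n w - mean t| <= d}.
Proof.
have H1 : {ae Q, forall w, forall k, average (ft (e k)) n w @[n --> \oo] --> mean (e k)}.
  by apply: ae_forall_nat => k; apply: (strong_law PQ); [exact: mft|exact: ift].
have H2 : {ae Q, forall w, average G n w @[n --> \oo] --> EG}.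
  exact: (strong_law PQ mG iG').
apply: ae_imply (ae_and ae_sample_in (ae_and H1 H2)) => w [Sw [H1w H2w]] d d0.
have d3 : 0 < d / 3 by rewrite divr_gt0.
have EG1 : 0 < EG + 1 by rewrite ltr_wpDl.
have dEG : 0 < d / 3 / (EG + 1) by rewrite divr_gt0.
have [K HK] := e_dense dEG.
have nearG : \forall n \near \oo, average G n w <= EG + 1.
  have /cvgrPdist_le/(_ _ ltr01) := H2w; apply: filterS => n.
  by rewrite ler_norml => /andP[? _]; lra.
have nearK : \forall n \near \oo, forall k, (k < K)%N ->
    `|average (ft (e k)) n w - mean (e k)| < d / 3.
  apply: near_forall_lt => k; have /cvgrPdist_lt/(_ _ d3) := H1w k.
  by apply: filterS => n; rewrite distrC.
apply: filterS2 nearG nearK => n Gn Kn t Tt.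
have [k kK tk] := HK t Tt.
rewrite ltr_pdivlMr// in tk.
apply: ltW; apply: dist_lt_thirds _ (Kn k kK) _.
  apply: le_lt_trans tk; rewrite mulrC.
  apply: (@le_trans _ _ (average G n w * `|t - e k|)); last by rewrite ler_wpM2r.
  by apply: dist_average_le => i; apply: ft_lipschitz.
apply: le_lt_trans tk; rewrite distrC mulrC.
rewrite (le_trans (dist_mean_le Tt (Te k)))//.
by rewrite ler_wpM2r// lerDl.
Qed.

(** For a fixed sample in [S], the averages are Lipschitz in [t] with constant [average G n w], so
    the dense sequence already attains the infimum as a limit. *)
Lemma estimator_eq_dense n (w : Om) : (forall k, S (w k)) ->
  importance_sampling_estimator T ft n w =
  ereal_inf [set (average (ft (e k)) n w)%:E | k in [set: nat]].
Proof.
move=> Sw; apply/eqP; rewrite eq_le; apply/andP; split.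
  apply: le_ereal_inf_tmp => _ [k _ <-]; apply: ereal_inf_lbound.
  by exists (e k); first exact: Te.
apply: le_ereal_inf_tmp => _ [t Tt <-]; rewrite -/(average (ft t) n w).
apply/lee_addgt0Pr => d d0.
have aG0 : 0 <= average G n w by rewrite mulr_ge0 ?invr_ge0// sumr_ge0.
have aG1 : 0 < average G n w + 1 by rewrite ltr_wpDl.
have dG : 0 < d / (average G n w + 1) by rewrite divr_gt0.
have [K HK] := e_dense dG.
have [k _ tk] := HK t Tt.
rewrite ltr_pdivlMr// in tk.
apply: (@le_trans _ _ (average (ft (e k)) n w)%:E).
  by apply: ereal_inf_lbound; exists k.
rewrite -EFinD lee_fin -lerBlDl.
have := @dist_average_le _ (ft (e k)) (ft t) G `|t - e k| n w.
have H i : `|ft (e k) (w i) - ft t (w i)| <= G (w i) * `|t - e k|.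
  by rewrite distrC; apply: ft_lipschitz.
move=> /(_ H)/(le_trans (ler_norm _))/le_trans; apply.
rewrite (le_trans _ (ltW tk))// mulrC ler_wpM2l// lerDl//.
Qed.

Lemma measurable_average_inf n :
  measurable_fun setT (fun w : Om =>
    ereal_inf [set (average (ft (e k)) n w)%:E | k in [set: nat]]).
Proof.
have mu k : measurable_fun setT (fun w : Om => (average (ft (e k)) n w)%:E).
  apply/measurable_EFinP; apply: measurable_funM => //.
  apply: measurable_sum => i.
  exact: (measurableT_comp (mft (Te k)) (measurable_coord i)).
rewrite (_ : (fun w => _) =
  (fun w : Om => einfs (fun k => (average (ft (e k)) n w)%:E) 0%N)).
  exact: (measurable_fun_einfs (f := fun k (w : Om) => (average (ft (e k)) n w)%:E)).
apply/funext => w; rewrite /einfs/= /sdrop; congr ereal_inf.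
by apply/seteqP; split => _ [k _ <-]; exists k.
Qed.

Lemma importance_sampling_strongly_consistent (theta : R) :
  ereal_inf [set (mean t)%:E | t in T] = theta%:E ->
  strongly_consistent Q (importance_sampling_estimator T ft) theta%:E.
Proof.
move=> inf_mean.
pose on_S (w : Om) := `[< forall k, S (w k) >].
have mS' : measurable_fun setT on_S.
  apply: (measurable_fun_bool true); rewrite setTI.
  rewrite (_ : _ @^-1` _ = \bigcap_k [set w : Om | S (w k)]).
    apply: bigcapT_measurable => k.
    by have := @measurable_coord R k measurableT _ mS; rewrite setTI.
  apply/seteqP; split => w /=; first by move=> /asboolP Sw k _; exact: Sw.
  by move=> Sw; apply/asboolP => k; exact: Sw.
(* The value [+oo] guarantees domination off the event [on_S]; on that event, which is almost sure,
   [hs] equals the covered map, and this gives minimality. *)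
pose hs n (w : Om) : \bar R := if on_S w then
  `|ereal_inf [set (average (ft (e k)) n w)%:E | k in [set: nat]] - theta%:E|%E
  else +oo%E.
have hsE n (w : Om) : (forall k, S (w k)) ->
    hs n w = `|importance_sampling_estimator T ft n w - theta%:E|%E.
  by move=> Sw; rewrite /hs /on_S asboolT// estimator_eq_dense.
exists hs; split => [n _|].
  split.
  - apply: measurable_fun_ifT => //.
    apply: measurableT_comp => //; apply: emeasurable_funB => //.
    exact: measurable_average_inf.
  - move=> w; have [Sw|nSw] := pselect (forall k, S (w k)).
      by rewrite hsE.
    by rewrite /hs /on_S asboolF// leey.
  - by move=> g _ hg; apply: ae_imply ae_sample_in => w Sw; rewrite hsE.
apply: ae_imply (ae_and ae_sample_in ae_uniform_average) => w [Sw uw].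
apply: cvge0_le_eps => [n|d d0]; first by rewrite hsE.
have := uw d d0; apply: filterS => n nd; rewrite hsE//.
exact: (ereal_inf_dist_le T_neq0 nd inf_mean).
Qed.

End uniform_strong_law.

(** * Application to the importance weights *)

Theorem theorem16 (R : realType) (m : nat) (m_gt0 : (0 < m)%N)
    (T : set 'rV[R]_m) (T_neq0 : T !=set0) (T_bounded : bounded_set T)
    (Pt : 'rV[R]_m -> probability R R)
    (pt : 'rV[R]_m -> R -> R)
    (pt_density : forall t, T t -> is_density (Pt t) (pt t))
    (P : probability R R) (p : R -> R)
    (p_density : is_density P p)
    (supp_pt : forall t, T t -> supp (pt t) `<=` supp p)
    (Pinf : probability (sample_space R) R)
    (Pinf_product : is_product_measure P Pinf)
    (f : R -> R)
    (f_meas : measurable_fun [set: R] f)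
    (f_sup : (ereal_sup [set 'E_(Pt t)[fun x => `|f x|%R]%E | t in T] < +oo)%E)
    (ft : 'rV[R]_m -> R -> R)
    (ft_meas : forall t, T t -> measurable_fun [set: R] (ft t))
    (ftE : forall t x, T t -> supp p x -> ft t x = f x * pt t x / p x)
    (N : 'rV[R]_m -> R) (N_norm : is_norm N)
    (Tc : set 'rV[R]_m) (Tc_open : open Tc) (T_Tc : convex_hull T `<=` Tc)
    (pTc : R -> 'rV[R]_m -> R)
    (pTc_meas : borel_measurable_on ([set: R] `*` Tc) (fun z => pTc z.1 z.2))
    (ptE : forall t, T t -> pt t = pTc ^~ t)
    (pTc_diff : forall x t, Tc t -> differentiable (pTc x) t)
    (F : R -> R)
    (F_meas : measurable_fun [set: R] F)
    (F_int : (\int[lebesgue_measure]_x (`|f x| * F x)%:E < +oo)%E)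
    (F_grad : forall x t, Tc t -> N (gradient (pTc x) t) <= F x) :
  strongly_consistent Pinf (importance_sampling_estimator T ft) (lower_expectation T Pt f).
Proof.
have [mp p0 _] := p_density.
have [t0 Tt0] := T_neq0.
have Tc_T t : T t -> Tc t.
  by move=> Tt; apply: T_Tc; apply: (sub_smallest (X := T)).
have F0 x : 0 <= F x.
  exact: le_trans (is_norm_ge0 _ N_norm) (F_grad x t0 (Tc_T _ Tt0)).
have [C C0 NC] := is_norm_equiv N_norm.
(* The segment stays in the convex hull, hence in [Tc]. The factor [m] comes from
   [derive_le_gradient], and [C] from replacing the maximum norm by [N]. *)
have pt_lipschitz s t x : T s -> T t ->
    `|pt s x - pt t x| <= m%:R * C * F x * `|s - t|.
  move=> Ts Tt; rewrite !ptE//; apply: mean_value_line => u u01.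
    by apply: pTc_diff; apply: T_Tc; exact: convex_hull_segment.
  have Tcu : Tc (t + u *: (s - t)) by apply: T_Tc; exact: convex_hull_segment.
  rewrite (le_trans (derive_le_gradient _ (pTc_diff x _ Tcu)))//.
  rewrite -mulrA -[leRHS]mulrA -[leRHS]mulrA ler_wpM2l// mulrC mulrA ler_wpM2r//.
  by rewrite (le_trans (NC _))// ler_wpM2l// F_grad.
(* Where [p x = 0] the convention for division makes [G x = 0]. *)
pose G x := m%:R * C * (`|f x| * F x / p x).
(* As [p] is nonnegative, its inverse is the real power of exponent -1. *)
have mpV : measurable_fun [set: R] (fun x => (p x)^-1).
  under eq_fun do rewrite -powR_inv1//.
  exact: (measurableT_comp (measurable_powR (-1)) mp).
have mfF : measurable_fun [set: R] (fun x => `|f x| * F x).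
  by apply: measurable_funM => //; exact: measurableT_comp.
have mG : measurable_fun [set: R] G.
  by apply: measurable_funM => //; exact: measurable_funM.
have G0 x : 0 <= G x by rewrite !mulr_ge0 ?invr_ge0.
(* Integrating against [P] multiplies by [p], which cancels the quotient where [p] is nonzero; what
   remains is at most [m * C] times the integrand of [F_int]. *)
have iG : (\int[P]_x (G x)%:E < +oo)%E.
  rewrite (ge0_integral_density p_density)//; last first.
    exact/measurable_EFinP.
  apply: (@le_lt_trans _ _
      (\int[lebesgue_measure]_x ((m%:R * C)%:E * (`|f x| * F x)%:E))%E).
    apply: ge0_le_integral => //.
    - by move=> x _; rewrite -EFinM lee_fin mulr_ge0.
    - apply: emeasurable_funM; exact/measurable_EFinP.
    - apply: emeasurable_funM => //; exact/measurable_EFinP.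
    - move=> x _; rewrite -!EFinM lee_fin /G -[leLHS]mulrA ler_wpM2l ?mulr_ge0//.
      have [->|px0] := eqVneq (p x) 0; first by rewrite mulr0 !mulr_ge0.
      by rewrite mulfVK.
  rewrite ge0_integralZl_EFin ?mulr_ge0//.
  - by apply: lte_mul_pinfty => //; rewrite lee_fin mulr_ge0.
  - by move=> x _; rewrite lee_fin mulr_ge0.
  - exact/measurable_EFinP.
(* Off [supp p] the inclusion of supports makes both densities vanish, so the identity holds
   whatever the value of [ft t x]. *)
have ft_transfer t x : T t -> ft t x * p x = f x * pt t x.
  move=> Tt; have [_ pt0 _] := pt_density _ Tt.
  have [px|] := ltP 0 (p x).
    by rewrite ftE// divfK// gt_eqF.
  move=> px; have -> : p x = 0 by apply/eqP; rewrite eq_le px p0.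
  have -> : pt t x = 0; last by rewrite !mulr0.
  apply/eqP; rewrite eq_le pt0 andbT leNgt; apply/negP => ptx.
  by have := supp_pt t Tt x ptx; rewrite /supp/= ltNge px.
have abs_ft t : T t -> (\int[P]_x (`|ft t x|)%:E = \int[Pt t]_x (`|f x|)%:E)%E.
  move=> Tt; apply: (integral_abs_transfer p_density (pt_density _ Tt)) => //.
    exact: ft_meas.
  by move=> x; exact: ft_transfer.
have mean_ft t : T t -> (\int[P]_x (ft t x)%:E = \int[Pt t]_x (f x)%:E)%E.
  move=> Tt; apply: (integral_transfer p_density (pt_density _ Tt)) => //.
    exact: ft_meas.
  by move=> x; exact: ft_transfer.
set M := ereal_sup _ in f_sup.
have abs_le_M t : T t -> (\int[P]_x (`|ft t x|)%:E <= M)%E.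
  move=> Tt; rewrite abs_ft//; apply: ereal_sup_ubound; exists t => //.
  by rewrite unlock.
have ift t : T t -> P.-integrable setT (EFin \o ft t).
  move=> Tt; apply/integrableP; split; last first.
    exact: le_lt_trans (abs_le_M _ Tt) f_sup.
  by apply/measurable_EFinP; exact: ft_meas.
have meanE t : T t -> 'E_(Pt t)[f]%E = (\int[P]_x ft t x)%:E.
  move=> Tt; rewrite unlock -mean_ft// /Rintegral fineK//.
  exact: (integrable_fin_num measurableT (ift _ Tt)).
have lower_expectationE : lower_expectation T Pt f =
    ereal_inf [set (\int[P]_x ft t x)%:E | t in T].
  congr ereal_inf; apply/seteqP; split => _ [t Tt <-].
    by exists t; rewrite ?meanE.
  by exists t; rewrite ?meanE.
(* All means are at least [- M], and the mean at [t0] bounds the infimum from above. *)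
have theta_fin : lower_expectation T Pt f \is a fin_num.
  have M_fin : M \is a fin_num.
    rewrite ge0_fin_numE//; apply: le_trans (abs_le_M _ Tt0).
    by apply: integral_ge0 => x _; rewrite lee_fin.
  rewrite fin_numElt lower_expectationE; apply/andP; split.
    apply: (@lt_le_trans _ _ (- M)%E).
      by rewrite -(fineK M_fin) -EFinN ltNyr.
    apply: le_ereal_inf_tmp => _ [t Tt <-].
    rewrite -(fineK M_fin) -EFinN lee_fin lerNl.
    rewrite (le_trans (ler_norm _))// normrN.
    rewrite (le_trans (le_normr_Rintegral measurableT (ift _ Tt)))//.
    rewrite -lee_fin (fineK M_fin) /Rintegral fineK; first exact: abs_le_M.
    exact: (integrable_fin_num measurableT (integrable_abse (ift _ Tt))).
  apply: (@le_lt_trans _ _ (\int[P]_x ft t0 x)%:E); last exact: ltry.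
  by apply: ereal_inf_lbound; exists t0.
have [e [Te e_dense]] := dense_sequence T_neq0 T_bounded.
have mS : measurable (supp p).
  rewrite -[supp p]setTI.
  apply: (measurable_lte measurableT (measurable_cst 0%:E) (g := EFin \o p)).
  exact/measurable_EFinP.
rewrite -(fineK theta_fin).
apply: (importance_sampling_strongly_consistent Pinf_product T_neq0 mS
  (null_setC_supp p_density) ft_meas ift mG G0 iG _ Te e_dense).
  move=> s t x Ts Tt px; rewrite !ftE// -mulrBl -mulrBr !normrM normfV.
  rewrite (ger0_norm (p0 x)) /G.
  apply: (@le_trans _ _ (`|f x| * (m%:R * C * F x * `|s - t|) / p x)).
    by rewrite ler_wpM2r ?invr_ge0// ler_wpM2l// pt_lipschitz.
  by rewrite le_eqVlt; apply/orP; left; apply/eqP; ring.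
by rewrite fineK// lower_expectationE.
Qed.
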